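(* Let $X\subset\mathbb{R}^n$, $p\in\overline{X}$, and $Y\subset\mathbb{R}^m$, $q\in\overline{Y}$, with the Euclidean (outer) metrics, and assume that the germs $(X,p)$ and $(Y,q)$ have unique tangent cones. If $(X,p)$ and $(Y,q)$ are quasi-isometric, then $C(X,p)$ and $C(Y,q)$ (with the metrics induced by the Euclidean distances) are bi-Lipschitz homeomorphic.
   Context: Tangent cones: for $X\subset\mathbb{R}^n$, $p\in\overline{X}$ and a sequence $\Lambda=(\lambda_i)$ of positive reals tending to $\infty$, $C(X,\Lambda,p)=\{v\in\mathbb{R}^n:\exists(x_i)\subset X,\ x_i\to p,\ \lim_{i\to\infty}\lambda_i(x_i-p)=v\}$. $X$ has a unique tangent cone at $p$ if $C(X,\Lambda,p)$ does not depend on $\Lambda$. Further, $C(X,p)=\{v\in\mathbb{R}^n:\exists(x_i)\subset X,\ x_i\to p,\ \exists(\lambda_i)\subset\mathbb{R}_+,\ \lambda_i\to\infty,\ v=\lim_{i\to\infty}\lambda_i(x_i-p)\}$. A horn function at $0$ is the germ at $0$ of a non-decreasing function $\varphi:\mathbb{R}_{\ge0}\to\mathbb{R}_{\ge0}$ with $\lim_{t\to0}\varphi(t)/t=0$. Local quasi-isometry: let $(X,p,d_X)$ and $(Y,q,d_Y)$ be metric germs. A map $f:(X,p)\to(Y,q)$ is a germ at $p$ of a map from a neighbourhood of $p$ in $X$ to $Y$, with $f(p)=q$ and $f(x)\to q$ as $x\to p$ (it need not be continuous away from $p$, nor injective). For subsets of Euclidean space with $p\in\overline{X}\setminus X$,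 the germ $(X,p)$ is understood as that of $X\cup\{p\}$ (similarly for $Y$). Let $\varphi$ be a horn function at $0$. The map $f$ is a $\varphi$-quasi-isometric embedding if there are constants $L\ge1$, $L_1,L_2>0$ and a neighbourhood $U$ of $p$ in $X$ such that for all $x,x'\in U$ $$\tfrac1L d_X(x,x')-\delta(x,x')\le d_Y(f(x),f(x'))\le L\,d_X(x,x')+\delta(x,x'),\qquad \delta(x,x')=L_1\varphi\big(L_2(d_X(x,p)+d_X(x',p))\big).$$ It is a $\varphi$-quasi-isometry if moreover there are a neighbourhood $V$ of $q$ in $Y$ and constants $L_1',L_2'>0$ such that for every $y\in V$ there is $x\in U$ with $d_Y(y,f(x))\le L_1'\varphi(L_2'd_X(x,p))$ (since $f$ and $\varphi$ are germs, this is understood for all sufficiently small $U$, with $V$ depending on $U$). $(X,p)$ and $(Y,q)$ are quasi-isometric if there is a $\varphi$-quasi-isometry $(X,p)\to(Y,q)$ for some horn function $\varphi$ at $0$. *)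

(* Defs.v *)
From HB Require Import structures.
From mathcomp Require Import all_boot all_order all_algebra.
From mathcomp Require Import all_classical all_reals all_analysis.
Set Implicit Arguments.
Unset Strict Implicit.
Unset Printing Implicit Defensive.
Import Order.TTheory GRing.Theory Num.Theory.
Import numFieldNormedType.Exports.
Local Open Scope classical_set_scope.
Local Open Scope ring_scope.

(* The library norm on ['rV[R]_n] is the sup norm, so the Euclidean distance
   is defined here. Both induce the same topology: limits, closures and
   neighbourhoods below are the library's, while all quantitative estimates
   use [edist]. *)
Definition edist (R : realType) (n : nat) (x y : 'rV[R]_n) : R :=
  Num.sqrt (\sum_(i < n) (x ord0 i - y ord0 i) ^+ 2).

Definition scaling (R : realType) (lam : nat -> R) : Prop :=
  (forall i, 0 < lam i) /\ (lam i @[i --> \oo] --> +oo).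

Definition tangent_cone_along (R : realType) (n : nat) (X : set 'rV[R]_n)
    (lam : nat -> R) (p : 'rV[R]_n) : set 'rV[R]_n :=
  [set v | exists x : nat -> 'rV[R]_n,
    [/\ forall i, X (x i),
        x i @[i --> \oo] --> p &
        lam i *: (x i - p) @[i --> \oo] --> v]].

Definition unique_tangent_cone (R : realType) (n : nat) (X : set 'rV[R]_n)
    (p : 'rV[R]_n) : Prop :=
  forall lam lam' : nat -> R, scaling lam -> scaling lam' ->
    tangent_cone_along X lam p = tangent_cone_along X lam' p.

Definition tangent_cone (R : realType) (n : nat) (X : set 'rV[R]_n)
    (p : 'rV[R]_n) : set 'rV[R]_n :=
  [set v | exists x : nat -> 'rV[R]_n,
    [/\ forall i, X (x i),
        x i @[i --> \oo] --> p &
        exists2 lam : nat -> R, scaling lam &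
          lam i *: (x i - p) @[i --> \oo] --> v]].

(* A representative of the germ; its values on negative reals are irrelevant. *)
Definition horn_function (R : realType) (phi : R -> R) : Prop :=
  [/\ forall t, 0 <= t -> 0 <= phi t,
      forall s t, 0 <= s -> s <= t -> phi s <= phi t &
      phi t / t @[t --> 0^'+] --> 0].

Definition nbhd_in (T : topologicalType) (A : set T) (p : T) (U : set T) :
    Prop :=
  exists2 W : set T, nbhs p W & U = A `&` W.

(* In what follows the germ of [X] at [p] is carried by [p |` X], which is [X]
   itself when [p] belongs to [X]. A germ of map is given by a total function,
   whose values matter only at the points of [p |` X] close to [p]. *)
Definition germ_map (R : realType) (n m : nat)
    (X : set 'rV[R]_n) (p : 'rV[R]_n) (Y : set 'rV[R]_m) (q : 'rV[R]_m)
    (f : 'rV[R]_n -> 'rV[R]_m) : Prop :=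
  [/\ f p = q,
      \forall x \near within (p |` X) (nbhs p), (q |` Y) (f x) &
      f x @[x --> within (p |` X) (nbhs p)] --> q].

Definition qi_embedding (R : realType) (n m : nat) (phi : R -> R)
    (X : set 'rV[R]_n) (p : 'rV[R]_n) (f : 'rV[R]_n -> 'rV[R]_m) : Prop :=
  exists L L1 L2 : R, [/\ 1 <= L, 0 < L1, 0 < L2 &
    exists2 U : set 'rV[R]_n, nbhd_in (p |` X) p U &
      forall x x' : 'rV[R]_n, U x -> U x' ->
        let delta := L1 * phi (L2 * (edist x p + edist x' p)) in
        L^-1 * edist x x' - delta <= edist (f x) (f x') /\
        edist (f x) (f x') <= L * edist x x' + delta].

(* The constants do not depend on the small neighbourhood [U]; [V] does. *)
Definition qi_surjective (R : realType) (n m : nat) (phi : R -> R)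
    (X : set 'rV[R]_n) (p : 'rV[R]_n) (Y : set 'rV[R]_m) (q : 'rV[R]_m)
    (f : 'rV[R]_n -> 'rV[R]_m) : Prop :=
  exists L1 L2 : R, [/\ 0 < L1, 0 < L2 &
    exists2 U0 : set 'rV[R]_n, nbhd_in (p |` X) p U0 &
      forall U : set 'rV[R]_n, nbhd_in (p |` X) p U -> U `<=` U0 ->
        exists2 V : set 'rV[R]_m, nbhd_in (q |` Y) q V &
          forall y : 'rV[R]_m, V y ->
            exists2 x : 'rV[R]_n, U x &
              edist y (f x) <= L1 * phi (L2 * edist x p)].

Definition quasi_isometry (R : realType) (n m : nat) (phi : R -> R)
    (X : set 'rV[R]_n) (p : 'rV[R]_n) (Y : set 'rV[R]_m) (q : 'rV[R]_m)
    (f : 'rV[R]_n -> 'rV[R]_m) : Prop :=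
  [/\ germ_map X p Y q f, qi_embedding phi X p f &
      qi_surjective phi X p Y q f].

Definition quasi_isometric (R : realType) (n m : nat)
    (X : set 'rV[R]_n) (p : 'rV[R]_n) (Y : set 'rV[R]_m) (q : 'rV[R]_m) :
    Prop :=
  exists2 phi : R -> R, horn_function phi &
    exists f : 'rV[R]_n -> 'rV[R]_m, quasi_isometry phi X p Y q f.

Definition bilipschitz_homeomorphic (R : realType) (n m : nat)
    (A : set 'rV[R]_n) (B : set 'rV[R]_m) : Prop :=
  exists2 g : 'rV[R]_n -> 'rV[R]_m, set_bij A B g &
    exists2 K : R, 1 <= K &
      forall v w : 'rV[R]_n, A v -> A w ->
        K^-1 * edist v w <= edist (g v) (g w) /\
        edist (g v) (g w) <= K * edist v w.

(* Main.v *)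
(* Blow up [f] along [lam i = i + 1]: if [lam i (x i - p) --> v], then
   [lam i (f (x i) - q)] is bounded, because the horn error disappears in the
   rescaling. One non-principal ultrafilter [F] on [nat] makes all these
   sequences converge simultaneously, which defines [g v]; passing to the limit
   in the quasi-isometry inequalities, [g] is bi-Lipschitz. An ultralimit of
   rescaled points is an honest limit for some other scaling, so it belongs to
   the tangent cone. Uniqueness of the cone of [X] realizes each [v] along
   [lam], and uniqueness of the cone of [Y] lifts each [w], realized along
   [lam], through almost surjectivity of [f]. *)
Require Import Defs.
From HB Require Import structures.
From mathcomp Require Import all_boot all_order all_algebra.
From mathcomp Require Import all_classical all_reals all_analysis.
From mathcomp Require Import ring lra.
Set Implicit Arguments.
Unset Strict Implicit.
Unset Printing Implicit Defensive.
Import Order.TTheory GRing.Theory Num.Theory.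
Import numFieldNormedType.Exports.
(* [mathcomp.analysis] also has an [edist], valued in the extended reals. *)
Import Defs.
Local Open Scope classical_set_scope.
Local Open Scope ring_scope.

(** * Euclidean distance and its comparison with the sup norm *)

Lemma sum_sqr_ge0 (R : realType) (I : finType) (a : I -> R) :
  0 <= \sum_i a i ^+ 2.
Proof. by apply: sumr_ge0 => i _; exact: sqr_ge0. Qed.

(** With [A], [B], [C] as in the proof, the nonnegative sum of the squares of [B * a i - C * b i]
    equals [B * (A * B - C ^+ 2)]. If [B = 0], every [b i] vanishes. *)
Lemma sum_cauchy_schwarz (R : realType) (I : finType) (a b : I -> R) :
  (\sum_i a i * b i) ^+ 2 <= (\sum_i a i ^+ 2) * (\sum_i b i ^+ 2).
Proof.
set A := \sum_i a i ^+ 2; set B := \sum_i b i ^+ 2; set C := \sum_i a i * b i.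
have hB : 0 <= B by exact: sum_sqr_ge0.
have [B0|B0] := eqVneq B 0.
  suff -> : C = 0 by rewrite B0 mulr0 expr0n.
  rewrite /C big1 // => i _.
  have /eqP := psumr_eq0P (fun i _ => sqr_ge0 (b i)) B0 (i := i) isT.
  by rewrite sqrf_eq0 => /eqP ->; rewrite mulr0.
have : 0 <= \sum_i (B * a i - C * b i) ^+ 2 by exact: sum_sqr_ge0.
have -> : \sum_i (B * a i - C * b i) ^+ 2 = B * (A * B - C ^+ 2).
  rewrite (eq_bigr (fun i => B ^+ 2 * a i ^+ 2 + ((- (B * C) *+ 2) * (a i * b i)
    + C ^+ 2 * b i ^+ 2))); last by move=> i _; ring.
  by rewrite !big_split /= -!mulr_sumr -/A -/B -/C; ring.
by rewrite pmulr_rge0 ?subr_ge0 // lt_def B0.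
Qed.

Lemma edist_ge0 (R : realType) n (x y : 'rV[R]_n) : 0 <= edist x y.
Proof. exact: sqrtr_ge0. Qed.

Lemma edistC (R : realType) n (x y : 'rV[R]_n) : edist x y = edist y x.
Proof. by congr Num.sqrt; apply: eq_bigr => i _; rewrite -sqrrN opprB. Qed.

Lemma edistxx (R : realType) n (x : 'rV[R]_n) : edist x x = 0.
Proof. by rewrite /edist big1 ?sqrtr0 // => i _; rewrite subrr expr0n. Qed.

Lemma edist_triangle (R : realType) n (y x z : 'rV[R]_n) :
  edist x z <= edist x y + edist y z.
Proof.
pose a (i : 'I_n) := x ord0 i - y ord0 i; pose b (i : 'I_n) := y ord0 i - z ord0 i.
rewrite -(@ler_pXn2r _ 2) ?nnegrE ?addr_ge0 ?edist_ge0 //.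
rewrite sqrrD !sqr_sqrtr ?sum_sqr_ge0 //.
rewrite (eq_bigr (fun i => a i ^+ 2 + ((a i * b i) *+ 2 + b i ^+ 2))); last first.
  by move=> i _; rewrite /a /b; ring.
rewrite 2!big_split /= sumrMnl addrA lerD2r lerD2l lerMn2r /=.
apply: le_trans (ler_norm _) _.
rewrite -(@ler_pXn2r _ 2) ?nnegrE ?mulr_ge0 ?edist_ge0 //.
by rewrite real_normK ?num_real // exprMn !sqr_sqrtr ?sum_sqr_ge0 // sum_cauchy_schwarz.
Qed.

Lemma edist_scale_shift (R : realType) n (a : R) (p x y : 'rV[R]_n) : 0 <= a ->
  edist (a *: (x - p)) (a *: (y - p)) = a * edist x y.
Proof.
move=> a0; rewrite /edist -[in RHS](ger0_norm a0) -sqrtr_sqr -sqrtrM ?sqr_ge0 //.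
by rewrite mulr_sumr; congr Num.sqrt; apply: eq_bigr => i _; rewrite !mxE; ring.
Qed.

Lemma edist_scale_shift0 (R : realType) n (a : R) (p x : 'rV[R]_n) : 0 <= a ->
  edist (a *: (x - p)) 0 = a * edist x p.
Proof. by move=> a0; rewrite -(edist_scale_shift p x p a0) subrr scaler0. Qed.

Lemma norm_le_edist (R : realType) n (x y : 'rV[R]_n) : `|x - y| <= edist x y.
Proof.
rewrite [leLHS]/Num.Def.normr /= mx_normrE; apply: bigmax_le => [|[i j] _] /=.
  exact: edist_ge0.
rewrite !mxE (ord1 i) -sqrtr_sqr ler_sqrt ?sum_sqr_ge0 // (bigD1 j) //= lerDl.
by apply: sumr_ge0 => k _; exact: sqr_ge0.
Qed.

Lemma edist_le_norm (R : realType) n (x y : 'rV[R]_n) :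
  edist x y <= Num.sqrt n%:R * `|x - y|.
Proof.
rewrite -[in leRHS](ger0_norm (normr_ge0 (x - y))) -sqrtr_sqr -sqrtrM //.
rewrite ler_sqrt ?mulr_ge0 ?sqr_ge0 //.
rewrite mulr_natl -[X in _ *+ X]card_ord -sumr_const; apply: ler_sum => i _.
rewrite -real_normK ?num_real // lerXn2r ?nnegrE //.
rewrite [leRHS]/Num.Def.normr /= mx_normrE.
by have := le_bigmax 0 (fun ij : 'I_1 * 'I_n => `|(x - y) ij.1 ij.2|) (ord0, i);
  rewrite /= !mxE.
Qed.

Lemma edist_eq0 (R : realType) n (x y : 'rV[R]_n) : edist x y = 0 -> x = y.
Proof.
move=> xy; apply/eqP; rewrite -subr_eq0 -normr_le0 -xy; exact: norm_le_edist.
Qed.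

Lemma cvg_edistP (R : realType) n (T : Type) (F : set_system T) (FF : Filter F)
    (u : T -> 'rV[R]_n) (v : 'rV[R]_n) :
  u x @[x --> F] --> v <-> edist (u x) v @[x --> F] --> 0.
Proof.
split=> [uv|uv].
  apply: (@squeeze_cvgr _ _ _ _ (fun=> 0) (fun x => Num.sqrt n%:R * `|u x - v|)).
  - by near=> x; rewrite edist_ge0 edist_le_norm.
  - exact: cvg_cst.
  - rewrite -[X in _ --> X](mulr0 (Num.sqrt n%:R)); apply: cvgMr.
    by rewrite -(normr0 'rV[R]_n) -(subrr v); apply: cvg_norm; apply: cvgB => //; exact: cvg_cst.
apply/cvgrPdist_lt => e e0.
move/cvgrPdist_lt : uv => /(_ _ e0).
apply: filterS => x; rewrite sub0r normrN ger0_norm ?edist_ge0 // => h.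
by rewrite distrC (le_lt_trans (norm_le_edist _ _)).
Unshelve. all: by end_near. Qed.

Lemma nbhs_edistP (R : realType) n (p : 'rV[R]_n) (W : set 'rV[R]_n) :
  nbhs p W <-> exists2 r, 0 < r & forall x, edist x p < r -> W x.
Proof.
split=> [/nbhs_ballP[r /= r0 rW]|[r r0 rW]].
  exists r => // x xr; apply: rW; rewrite -ball_normE /= distrC.
  exact: le_lt_trans (norm_le_edist _ _) xr.
have : edist x p @[x --> p] --> 0 by exact: (cvg_edistP (nbhs_filter p) id p).1 cvg_id.
move=> /cvgrPdist_lt /(_ _ r0); apply: filterS => x.
by rewrite sub0r normrN ger0_norm ?edist_ge0 //; exact: rW.
Qed.

Lemma cvg_edist (R : realType) n (T : Type) (F : set_system T) (FF : Filter F)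
    (u w : T -> 'rV[R]_n) (a b : 'rV[R]_n) :
  u x @[x --> F] --> a -> w x @[x --> F] --> b ->
  edist (u x) (w x) @[x --> F] --> edist a b.
Proof.
move=> /cvg_edistP ua /cvg_edistP wb.
apply: (@squeeze_cvgr _ _ _ _
  (fun x => edist a b - (edist (u x) a + edist (w x) b))
  (fun x => edist a b + (edist (u x) a + edist (w x) b))).
- near=> x.
  have h1 := edist_triangle (u x) a b; have h2 := edist_triangle (w x) (u x) b.
  have h3 := edist_triangle a (u x) (w x); have h4 := edist_triangle b a (w x).
  by rewrite (edistC a (u x)) in h1; rewrite (edistC b (w x)) in h4; lra.
- rewrite -[X in _ --> X]subr0 -[X in _ - X](addr0 0).
  by apply: cvgB; [exact: cvg_cst|exact: cvgD].
- rewrite -[X in _ --> X]addr0 -[X in _ + X](addr0 0).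
  by apply: cvgD; [exact: cvg_cst|exact: cvgD].
Unshelve. all: by end_near. Qed.

(** * Ultralimits, horn functions and rescaled sequences *)

(** Closed balls of the sup norm are compact, so the image filter clusters at some [w]. For an
    ultrafilter a cluster point is a limit: if a neighbourhood [N] of [w] had its preimage outside
    [F], the complement of [N] would belong to the image filter and would have to meet [N]. *)
Lemma ultrafilter_bounded_cvg (R : realType) n (T : Type) (F : set_system T)
    (FU : UltraFilter F) (u : T -> 'rV[R]_n) (M : R) :
  (\forall x \near F, edist (u x) 0 <= M) ->
  exists w : 'rV[R]_n, u x @[x --> F] --> w.
Proof.
move=> uM.
have : compact [set v : 'rV[R]_n | `|v| <= M].
  apply: bounded_closed_compact.
    exists M; split; first exact: num_real.
    by move=> N MN v /= vM; rewrite (le_trans vM) // ltW.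
  apply: (@closed_comp _ _ (fun v : 'rV[R]_n => `|v|) [set x | x <= M]).
    by move=> v _; exact: norm_continuous.
  exact: closed_le.
move=> /(_ (u x @[x --> F]) (fmap_proper_filter _ _))[|w [_ wcl]].
  apply: filterS uM => x /=; apply: le_trans; rewrite -[u x in leLHS]subr0.
  exact: norm_le_edist.
exists w => N wN; case: (in_ultra_setVsetC (u @^-1` N) FU) => // FN.
by have [z [nNz /nNz]] := wcl (~` N) N FN wN.
Qed.

(** For [t > 0] this is the limit of [phi t / t] unfolded. That limit says nothing about [t = 0],
    where monotonicity forces [phi 0 = 0]. *)
Lemma horn_small (R : realType) (phi : R -> R) : horn_function phi ->
  forall e, 0 < e ->
  exists2 d, 0 < d & forall t, 0 <= t -> t < d -> phi t <= e * t.
Proof.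
move=> [phi_ge0 phi_homo phi0] e e0.
have : \forall t \near 0^'+, phi t <= e * t.
  move/cvgrPdist_lt : phi0 => /(_ _ e0) h; near=> t.
  have t0 : 0 < t by near: t; exact: nbhs_right_gt.
  have : `|0 - phi t / t| < e by near: t.
  rewrite sub0r normrN ger0_norm; last by rewrite divr_ge0 ?phi_ge0 // ltW.
  by rewrite ltr_pdivrMr // => /ltW.
move=> [d /= d0 hd].
have {}hd t : 0 < t -> t < d -> phi t <= e * t.
  by move=> t0 td; apply: hd => //=; rewrite sub0r normrN gtr0_norm.
exists d => // t; rewrite le_eqVlt => /predU1P[<- _|]; last exact: hd.
rewrite mulr0 leNgt; apply/negP => phi00.
(* The second bound on [s] gives [phi 0 <= phi s <= e * s <= phi 0 / 2], which contradicts
   [phi 0 > 0]. *)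
pose s := Num.min (d / 2) (phi 0 / (2 * e)).
have s0 : 0 < s by rewrite lt_min !divr_gt0 ?mulr_gt0.
have sd : s < d by rewrite gt_min ltr_pdivrMr // ltr_pMr // ltrDl ltr01.
have : s <= phi 0 / (2 * e) by rewrite ge_min lexx orbT.
rewrite ler_pdivlMr ?mulr_gt0 // => se.
have h1 := hd s s0 sd.
have h2 := phi_homo 0 s (lexx _) (ltW s0).
nra.
Unshelve. all: by end_near. Qed.

(** Since [s i] is of order [1 / lam i], it tends to [0], and [phi (C * s i)] is eventually at most
    an arbitrarily small multiple of [s i]; the factor [lam i] then only restores a bounded
    quantity. This is why horn errors vanish in the blow-up. *)
Lemma rescaled_horn_cvg0 (R : realType) (T : Type) (F : set_system T)
    (FF : Filter F) (phi : R -> R) (lam s : T -> R) (C M : R) :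
  horn_function phi -> 0 < C -> lam i @[i --> F] --> +oo ->
  (\forall i \near F, 0 <= s i) -> (\forall i \near F, lam i * s i <= M) ->
  lam i * phi (C * s i) @[i --> F] --> 0.
Proof.
move=> hphi C0 lamoo s_ge0 sM; apply/cvgrPdist_lt => e e0.
(* A strictly positive bound in place of [M], so that one can divide by [C * N]. The slope
   [e / (2 * (C * N))] below makes the final estimate [e / 2], and [lam i > C * N / d] ensures
   [C * s i < d]. *)
pose N := `|M| + 1.
have N0 : 0 < N by rewrite ltr_wpDl.
have MN : M <= N by rewrite (le_trans (ler_norm M)) // lerDl.
have CN0 : 0 < C * N by rewrite mulr_gt0.
have [d d0 hd] := horn_small hphi (divr_gt0 e0 (mulr_gt0 (ltr0Sn R 1) CN0)).
move/cvgryPgt : lamoo => /(_ (C * N / d)) lamoo.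
near=> i.
have si : 0 <= s i by near: i.
have : C * N / d < lam i by near: i.
rewrite ltr_pdivrMr // => lami.
have lam0 : 0 < lam i by rewrite -(pmulr_lgt0 _ d0) (lt_trans _ lami).
have lamsi : lam i * s i <= N by rewrite (le_trans _ MN) //; near: i.
have Csd : C * s i < d.
  by rewrite -(ltr_pM2l lam0); apply: le_lt_trans lami; rewrite mulrCA ler_pM2l.
have Cs0 : 0 <= C * s i by rewrite mulr_ge0 // ltW.
have [phi_ge0 _ _] := hphi.
rewrite sub0r normrN ger0_norm ?mulr_ge0 ?phi_ge0 ?(ltW lam0) //.
apply: (@le_lt_trans _ _ (e / (2 * (C * N)) * (C * N))).
  apply: (@le_trans _ _ (lam i * (e / (2 * (C * N)) * (C * s i)))).
    by rewrite ler_pM2l //; exact: hd.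
  rewrite mulrCA ler_pM2l ?divr_gt0 ?mulr_gt0 // mulrCA ler_pM2l //.
have -> : e / (2 * (C * N)) * (C * N) = e / 2 by field; rewrite !gt_eqF.
by rewrite ltr_pdivrMr // ltr_pMr // ltrDl ltr01.
Unshelve. all: by end_near. Qed.

Lemma rescaled_bounded_cvg (R : realType) n (T : Type) (F : set_system T)
    (FF : Filter F) (lam : T -> R) (x : T -> 'rV[R]_n) (p : 'rV[R]_n) (M : R) :
  lam i @[i --> F] --> +oo -> (\forall i \near F, lam i * edist (x i) p <= M) ->
  x i @[i --> F] --> p.
Proof.
move=> lamoo xM; apply/(cvg_edistP FF); apply/cvgrPdist_lt => e e0.
move/cvgryPgt : lamoo => /(_ (`|M| / e)) lamoo.
near=> i.
have : `|M| / e < lam i by near: i.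
rewrite ltr_pdivrMr // => lami; rewrite sub0r normrN (ger0_norm (edist_ge0 _ _)) //.
have lam0 : 0 < lam i by rewrite -(pmulr_lgt0 _ e0) (le_lt_trans _ lami).
rewrite -(ltr_pM2l lam0) (le_lt_trans _ lami) // (le_trans _ (ler_norm M)) //.
by near: i.
Unshelve. all: by end_near. Qed.

Lemma rescaled_cvg_bounded (R : realType) n (T : Type) (F : set_system T)
    (FF : Filter F) (lam : T -> R) (x : T -> 'rV[R]_n) (p v : 'rV[R]_n) :
  (\forall i \near F, 0 < lam i) ->
  lam i *: (x i - p) @[i --> F] --> v ->
  \forall i \near F, lam i * edist (x i) p <= edist v 0 + 1.
Proof.
move=> lam0 /cvg_edistP /cvgrPdist_lt /(_ _ ltr01) xv; near=> i.
rewrite -edist_scale_shift0; last by apply: ltW; near: i.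
rewrite (le_trans (edist_triangle v _ _)) // addrC lerD2l.
rewrite -[leLHS](ger0_norm (edist_ge0 _ _)) -normrN -sub0r ltW //.
by near: i.
Unshelve. all: by end_near. Qed.

(** * Quasi-isometries under rescaling *)

(** The bound [M] does two things: it brings [x i] and [x' i] eventually into the neighbourhood
    where the inequalities hold, and it makes the rescaled horn error [eps] tend to [0]. The filter
    [F] is arbitrary above [\oo] so that the estimate can be used along an ultrafilter. *)
Lemma qi_embedding_rescaled (R : realType) n m (phi : R -> R)
    (X : set 'rV[R]_n) (p : 'rV[R]_n) (f : 'rV[R]_n -> 'rV[R]_m) :
  horn_function phi -> qi_embedding phi X p f ->
  exists2 L, 1 <= L & forall (F : set_system nat) (FF : Filter F)
    (lam : nat -> R) (x x' : nat -> 'rV[R]_n) (M : R),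
  scaling lam -> \oo `<=` F ->
  (\forall i \near F, (p |` X) (x i)) -> (\forall i \near F, (p |` X) (x' i)) ->
  (\forall i \near F, lam i * edist (x i) p <= M) ->
  (\forall i \near F, lam i * edist (x' i) p <= M) ->
  exists2 eps : nat -> R, eps i @[i --> F] --> 0 & \forall i \near F,
    L^-1 * (lam i * edist (x i) (x' i)) - eps i <=
      lam i * edist (f (x i)) (f (x' i)) /\
    lam i * edist (f (x i)) (f (x' i)) <=
      L * (lam i * edist (x i) (x' i)) + eps i.
Proof.
move=> hphi [L [L1 [L2 [L_ge1 L1_gt0 L2_gt0 [_ [W pW ->] fU]]]]].
exists L => // F FF lam x x' M [lam0 lamoo] Foo Xx Xx' xM x'M.
have {}lamoo : lam i @[i --> F] --> +oo by move=> A /lamoo; exact: Foo.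
exists (fun i => L1 * (lam i * phi (L2 * (edist (x i) p + edist (x' i) p)))).
  rewrite -[X in _ --> X](mulr0 L1); apply: cvgMr.
  apply: (@rescaled_horn_cvg0 _ _ _ _ _ _ _ _ (M + M)) => //.
    by near=> i; rewrite addr_ge0 ?edist_ge0.
  by near=> i; rewrite mulrDr lerD //; near: i.
have xW := rescaled_bounded_cvg FF lamoo xM pW.
have x'W := rescaled_bounded_cvg FF lamoo x'M pW.
near=> i.
have Ux : ((p |` X) `&` W) (x i) by split; near: i.
have Ux' : ((p |` X) `&` W) (x' i) by split; near: i.
have [/= lo hi] := fU _ _ Ux Ux'.
have li := lam0 i; split.
  rewrite [L1 * _]mulrCA [L^-1 * _]mulrCA -mulrBr ler_pM2l //.
by rewrite [L1 * _]mulrCA [L * _]mulrCA -mulrDr ler_pM2l.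
Unshelve. all: by end_near. Qed.

(** Almost surjectivity bounds the error in terms of [edist x p], whereas the blow-up needs
    [edist x p] bounded in terms of [edist y q]. Comparing [x] with [p] in the embedding inequality
    gives this, once both horn errors are absorbed for [x] close to [p]. *)
Lemma qi_preimage (R : realType) n m (phi : R -> R) (X : set 'rV[R]_n)
    (p : 'rV[R]_n) (Y : set 'rV[R]_m) (q : 'rV[R]_m)
    (f : 'rV[R]_n -> 'rV[R]_m) :
  horn_function phi -> quasi_isometry phi X p Y q f ->
  exists K L1 L2 : R, [/\ 0 < K, 0 < L1, 0 < L2 &
    \forall y \near within (q |` Y) (nbhs q), exists x,
      [/\ (p |` X) x, edist x p <= K * edist y q &
          edist y (f x) <= L1 * phi (L2 * edist x p)]].
Proof.
move=> hphi [[fp _ _] [L [L1 [L2 [L_ge1 L1_gt0 L2_gt0 [_ [W pW ->] fU]]]]]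
  [L1' [L2' [L1'_gt0 L2'_gt0 [_ [W0 pW0 ->] fV]]]]].
have L0 : 0 < L by rewrite (lt_le_trans _ L_ge1).
exists (4 * L), L1', L2'; split => //; first by rewrite mulr_gt0.
(* The slopes are chosen so that near [p] the embedding error is at most [edist x p / (2 * L)] and
   the surjectivity error at most [edist x p / (4 * L)]. What remains of [L^-1 * edist x p] is
   [edist x p / (4 * L)], whence [K = 4 * L]. *)
have [d d0 hd] := @horn_small _ _ hphi ((2 * L * L1 * L2)^-1) ltac:(by rewrite invr_gt0 !mulr_gt0).
have [d' d'0 hd'] := @horn_small _ _ hphi ((4 * L * L1' * L2')^-1) ltac:(by rewrite invr_gt0 !mulr_gt0).
pose B := [set x : 'rV[R]_n | edist x p < Num.min (d / L2) (d' / L2')].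
have pB : nbhs p B.
  apply/nbhs_edistP; exists (Num.min (d / L2) (d' / L2')) => //.
  by rewrite lt_min !divr_gt0.
(* Almost surjectivity holds for every small neighbourhood of [p], so the approximate preimage can
   be sought inside [B], where both horn estimates apply. *)
have [||V [V' qV' ->] hV] := fV ((p |` X) `&` (W `&` W0 `&` B)).
- by exists (W `&` W0 `&` B) => //; apply: filterI => //; exact: filterI.
- by move=> x [Xx [[_ ?] _]].
apply: filterS qV' => y V'y Yy; have [//|x [Xx [[Wx _] Bx]] yfx] := hV y.
exists x; split => //.
have Up : ((p |` X) `&` W) p by split; [left|exact: nbhs_singleton].
have Ux : ((p |` X) `&` W) x by [].
have [+ _] := fU x p Ux Up; rewrite /= fp edistxx addr0 => lo.
move: Bx; rewrite /B /= lt_min !ltr_pdivlMr // => /andP[xd xd'].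
have t0 := edist_ge0 x p.
have {}hd : L1 * phi (L2 * edist x p) <= edist x p / (2 * L).
  have -> : edist x p / (2 * L) = L1 * ((2 * L * L1 * L2)^-1 * (L2 * edist x p)).
    by field; rewrite !gt_eqF.
  by rewrite ler_pM2l //; apply: hd; rewrite 1?mulrC // mulr_ge0 // ltW.
have {}hd' : L1' * phi (L2' * edist x p) <= edist x p / (4 * L).
  have -> : edist x p / (4 * L) = L1' * ((4 * L * L1' * L2')^-1 * (L2' * edist x p)).
    by field; rewrite !gt_eqF.
  by rewrite ler_pM2l //; apply: hd'; rewrite 1?mulrC // mulr_ge0 // ltW.
have tri := edist_triangle y (f x) q; rewrite (edistC (f x) y) in tri.
have {}lo : edist x p / (4 * L) <= edist y q.
  have e1 : L^-1 * edist x p = 4 * (edist x p / (4 * L)) by field; rewrite gt_eqF.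
  have e2 : edist x p / (2 * L) = 2 * (edist x p / (4 * L)) by field; rewrite gt_eqF.
  by rewrite e1 in lo; rewrite e2 in hd; lra.
by move: lo; rewrite ler_pdivrMr ?mulr_gt0 // mulrC.
Qed.

(** * Tangent cones and limits along filters *)

(** For each [k], a set of [F] supplies an index at least [k] whose rescaled point is within
    [1 / (k + 1)] of [v]. The scalings at these indices still tend to infinity, so the selected
    points form an ordinary sequence that exhibits [v] in the cone. *)
Lemma tangent_cone_filter (R : realType) n (X : set 'rV[R]_n) (p v : 'rV[R]_n)
    (F : set_system nat) (FF : ProperFilter F) (lam : nat -> R)
    (x : nat -> 'rV[R]_n) :
  closure X p -> scaling lam -> \oo `<=` F ->
  (\forall i \near F, (p |` X) (x i)) ->
  lam i *: (x i - p) @[i --> F] --> v -> tangent_cone X p v.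
Proof.
move=> pX [lam0 lamoo] Foo Xx xv.
have approx k : exists iz : nat * 'rV[R]_n, [/\ (k <= iz.1)%N, X iz.2 &
    edist (lam iz.1 *: (iz.2 - p)) v <= k.+1%:R^-1 + k.+1%:R^-1].
  have k0 : 0 < k.+1%:R^-1 :> R by rewrite invr_gt0.
  have Fk : F [set i | (k <= i)%N] by apply: Foo; exact: nbhs_infty_ge.
  have /cvg_edistP /cvgrPdist_lt /(_ _ k0) xvk := xv.
  have [i [[ki xvi] [xp|Xxi]]] := filter_ex (filterI (filterI Fk xvk) Xx).
    (* The point may be [p] itself, possibly outside [X]. It is then replaced by a point of [X] so
       close that rescaling moves it by at most [1 / (k + 1)], which accounts for the second summand
       in [approx]. *)
    have [z [Xz zp]] : X `&` [set z | edist z p < k.+1%:R^-1 / lam i] !=set0.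
      by apply: pX; apply/nbhs_edistP; exists (k.+1%:R^-1 / lam i);
        rewrite ?divr_gt0.
    exists (i, z); split => //=.
    rewrite (le_trans (edist_triangle 0 _ _)) // lerD //.
      rewrite edist_scale_shift0 ?(ltW (lam0 i)) //.
      by rewrite mulrC -ler_pdivlMr // ltW.
    move: xvi; rewrite /= xp subrr scaler0 sub0r normrN (ger0_norm (edist_ge0 _ _)) //.
    exact: ltW.
  exists (i, x i); split => //=.
  move: xvi; rewrite /= sub0r normrN (ger0_norm (edist_ge0 _ _)) // => /ltW /le_trans.
  by apply; rewrite lerDl ltW.
have [iz izP] := choice approx.
pose mu k := lam (iz k).1; pose z k := (iz k).2.
have mu0 k : 0 < mu k by exact: lam0.
have muoo : mu k @[k --> \oo] --> +oo.
  apply/cvgryPgt => A; move/cvgryPgt : lamoo => /(_ A) [N _ hN].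
  exists N => // k /= Nk; have [kiz _ _] := izP k.
  by apply: hN; rewrite /= (leq_trans Nk).
have zv : mu k *: (z k - p) @[k --> \oo] --> v.
  apply/cvg_edistP.
  apply: (@squeeze_cvgr _ _ _ _ (fun=> 0) (fun k => k.+1%:R^-1 + k.+1%:R^-1)).
  - by near=> k; have [_ _ ->] := izP k; rewrite edist_ge0.
  - exact: cvg_cst.
  - by rewrite -[X in _ --> X](addr0 0); apply: cvgD; exact: cvg_harmonic.
exists z; split; [by move=> k; have [] := izP k| |by exists mu].
apply: (rescaled_bounded_cvg _ muoo).
by apply: rescaled_cvg_bounded zv; near=> k.
Unshelve. all: by end_near. Qed.

Lemma unique_tangent_coneE (R : realType) n (X : set 'rV[R]_n) (p : 'rV[R]_n)
    (lam : nat -> R) :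
  unique_tangent_cone X p -> scaling lam ->
  tangent_cone X p = tangent_cone_along X lam p.
Proof.
move=> hX hlam; apply/seteqP; split => v [x [Xx xp]].
  move=> [mu hmu xv]; rewrite (hX _ mu) //; by exists x.
by move=> xv; exists x; split => //; exists lam.
Qed.

(** * The blow-up map between the tangent cones *)

Theorem theorem4p2 (R : realType) (n m : nat)
    (X : set 'rV[R]_n) (p : 'rV[R]_n) (Y : set 'rV[R]_m) (q : 'rV[R]_m)
    (hp : closure X p) (hq : closure Y q)
    (hX : unique_tangent_cone X p) (hY : unique_tangent_cone Y q)
    (hXY : quasi_isometric X p Y q) :
  bilipschitz_homeomorphic (tangent_cone X p) (tangent_cone Y q).
Proof.
have [phi hphi [f hf]] := hXY.
have [[fp fY _] femb _] := hf.
have [L L_ge1 distort] := qi_embedding_rescaled hphi femb.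
have L0 : 0 < L by rewrite (lt_le_trans _ L_ge1).
have [F [FU Foo]] := ultraFilterLemma (eventually_filter : ProperFilter \oo).
have FF : Filter F by exact: _.
pose lam (i : nat) : R := i.+1%:R.
have lam_pos i : 0 < lam i by rewrite ltr0n.
have hlam : scaling lam.
  split => //; apply/cvgryPge => A; exists (Num.trunc `|A|).+1 => // i /= Ai.
  rewrite (le_trans (ler_norm A)) // ltW // (lt_le_trans (truncnS_gt _)) //.
  by rewrite ler_nat ltnW.
have lamF : lam i @[i --> F] --> +oo by move=> A /hlam.2; exact: Foo.
have near_lam : \forall i \near F, 0 < lam i by near=> i.
have Xp : \forall i \near F, (p |` X) p by near=> i; left.
(* Compare [x i] with the constant sequence [p], using [f p = q]. The summand [1] bounds the
   rescaled error [eps], and the proof uses [|M|] because the constant sequence requires a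
   nonnegative bound. *)
have image_bounded (x : nat -> 'rV[R]_n) M :
    (\forall i \near F, (p |` X) (x i)) ->
    (\forall i \near F, lam i * edist (x i) p <= M) ->
    (\forall i \near F, (q |` Y) (f (x i))) /\
    (\forall i \near F, lam i * edist (f (x i)) q <= L * M + 1).
  move=> Xx xM; have xp := rescaled_bounded_cvg FF lamF xM.
  split.
    have fxY : \forall i \near F, (p |` X) (x i) -> (q |` Y) (f (x i)).
      exact: xp fY.
    by apply: filterS2 fxY Xx => i; apply.
  have M0 : \forall i \near F, lam i * edist p p <= `|M|.
    by near=> i; rewrite edistxx mulr0.
  have xM' : \forall i \near F, lam i * edist (x i) p <= `|M|.
    by apply: filterS xM => i /le_trans; apply; exact: ler_norm.
  have [eps eps0 heps] := distort F _ lam x (fun=> p) `|M| hlam Foo Xx Xp xM' M0.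
  move/cvgrPdist_lt : eps0 => /(_ _ ltr01) eps1.
  apply: filterS3 heps xM eps1 => i [_ fxi] xi epsi.
  rewrite -fp (le_trans fxi) // lerD ?ler_pM2l // (le_trans (ler_norm _)) //.
  by rewrite -normrN -sub0r ltW.
have limit_bounds (x x' : nat -> 'rV[R]_n) (v v' : 'rV[R]_n)
    (w w' : 'rV[R]_m) :
    (\forall i \near F, (p |` X) (x i)) -> (\forall i \near F, (p |` X) (x' i)) ->
    lam i *: (x i - p) @[i --> F] --> v -> lam i *: (x' i - p) @[i --> F] --> v' ->
    lam i *: (f (x i) - q) @[i --> F] --> w ->
    lam i *: (f (x' i) - q) @[i --> F] --> w' ->
    L^-1 * edist v v' <= edist w w' /\ edist w w' <= L * edist v v'.
  move=> Xx Xx' xv xv' fw fw'.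
  have dv := cvg_edist FF xv xv'; have dw := cvg_edist FF fw fw'.
  have xM : \forall i \near F, lam i * edist (x i) p <=
      Num.max (edist v 0 + 1) (edist v' 0 + 1).
    apply: filterS (rescaled_cvg_bounded FF near_lam xv) => i ?.
    by rewrite le_max (_ : _ <= edist v 0 + 1).
  have xM' : \forall i \near F, lam i * edist (x' i) p <=
      Num.max (edist v 0 + 1) (edist v' 0 + 1).
    apply: filterS (rescaled_cvg_bounded FF near_lam xv') => i ?.
    by rewrite le_max orbC (_ : _ <= edist v' 0 + 1).
  have [eps eps0 heps] := distort F _ lam x x' _ hlam Foo Xx Xx' xM xM'.
  split.
    rewrite -[leLHS]subr0; apply: (ler_cvg_to _ dw).
      by apply: cvgB; [apply: cvgMr; exact: dv|exact: eps0].
    apply: filterS heps => i [+ _].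
    by rewrite !fctE /= !edist_scale_shift ?(ltW (lam_pos i)).
  rewrite -[leRHS]addr0; apply: (@ler_cvg_to _ F _ _ _ _ _ _ dw).
    by apply: cvgD; [apply: cvgMr; exact: dv|exact: eps0].
  apply: filterS heps => i [_].
  by rewrite !fctE /= !edist_scale_shift ?(ltW (lam_pos i)).
(* The existential [w] precedes the membership hypothesis so that choice yields a total [g], with
   the default value [0] outside the cone. *)
have image_limit : forall v, exists w : 'rV[R]_m, tangent_cone X p v ->
    exists x : nat -> 'rV[R]_n, [/\ \forall i \near F, (p |` X) (x i),
      lam i *: (x i - p) @[i --> F] --> v &
      lam i *: (f (x i) - q) @[i --> F] --> w].
  move=> v; have [|nv] := pselect (tangent_cone X p v); last by exists 0.
  rewrite (unique_tangent_coneE hX hlam) => -[x [Xx _ xv]].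
  have {}Xx : \forall i \near F, (p |` X) (x i) by near=> i; right.
  have {}xv : lam i *: (x i - p) @[i --> F] --> v by move=> A /xv; exact: Foo.
  have [_ fxM] := image_bounded _ _ Xx (rescaled_cvg_bounded FF near_lam xv).
  have [|w fw] := @ultrafilter_bounded_cvg _ _ _ F FU
    (fun i => lam i *: (f (x i) - q)) (L * (edist v 0 + 1) + 1).
    by apply: filterS fxM => i; rewrite edist_scale_shift0 // ltW.
  by exists w => _; exists x.
have [g hg] := choice image_limit.
have g_bilip v v' : tangent_cone X p v -> tangent_cone X p v' ->
    L^-1 * edist v v' <= edist (g v) (g v') /\
    edist (g v) (g v') <= L * edist v v'.
  move=> /hg[x [Xx xv fx]] /hg[x' [Xx' xv' fx']].
  exact: limit_bounds xv xv' fx fx'.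
exists g; last by exists L.
split.
- move=> v /hg[x [Xx xv fx]].
  have [fY' _] := image_bounded _ _ Xx (rescaled_cvg_bounded FF near_lam xv).
  exact: tangent_cone_filter hq hlam Foo fY' fx.
- move=> v v'; rewrite !inE => Cv Cv' gvv'; have [+ _] := g_bilip _ _ Cv Cv'.
  rewrite gvv' edistxx pmulr_rle0 ?invr_gt0 // => vv'.
  by apply: edist_eq0; apply/eqP; rewrite eq_le vv' edist_ge0.
- move=> w; rewrite (unique_tangent_coneE hY hlam) => -[y [Yy _ yw]].
  have {}yw : lam i *: (y i - q) @[i --> F] --> w by move=> A /yw; exact: Foo.
  have yM := rescaled_cvg_bounded FF near_lam yw.
  have [K [L1 [L2 [K0 L1_gt0 L2_gt0 pre]]]] := qi_preimage hphi hf.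
  pose lift y x := [/\ (p |` X) x, edist x p <= K * edist y q &
    edist y (f x) <= L1 * phi (L2 * edist x p)].
  have near_lift : \forall i \near F, (q |` Y) (y i) -> exists x, lift (y i) x.
    exact: (rescaled_bounded_cvg FF lamF yM pre).
  (* The default [p] serves the indices where [y i] has no lift; [near_lift] shows that these do not
     matter along [F]. *)
  have ex_lift i : exists x, (exists x, lift (y i) x) -> lift (y i) x.
    have [[x ?]|no] := pselect (exists x, lift (y i) x); first by exists x.
    by exists p => /no.
  have [x hx] := choice ex_lift.
  have {}hx : \forall i \near F, lift (y i) (x i).
    by apply: filterS near_lift => i yi; apply/hx/yi; right.
  have Xx : \forall i \near F, (p |` X) (x i) by apply: filterS hx => i [].
  have xM : \forall i \near F, lam i * edist (x i) p <= K * (edist w 0 + 1).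
    apply: filterS2 hx yM => i [_ xi _] yi.
    rewrite (le_trans _ (_ : K * (lam i * edist (y i) q) <= _)) ?ler_pM2l //.
    by rewrite mulrCA ler_pM2l.
  have [|v xv] := @ultrafilter_bounded_cvg _ _ _ F FU
    (fun i => lam i *: (x i - p)) (K * (edist w 0 + 1)).
    by apply: filterS xM => i; rewrite edist_scale_shift0 // ltW.
  have Cv : tangent_cone X p v by exact: tangent_cone_filter hp hlam Foo Xx xv.
  (* The rescaled distance from [f (x i)] to [y i] is at most a horn error, so both rescaled
     sequences have the limit [w]. *)
  have fw : lam i *: (f (x i) - q) @[i --> F] --> w.
    have horn0 : lam i * phi (L2 * edist (x i) p) @[i --> F] --> 0.
      apply: (rescaled_horn_cvg0 _ hphi L2_gt0 lamF _ xM).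
      by near=> i; exact: edist_ge0.
    apply/cvg_edistP.
    apply: (@squeeze_cvgr _ _ _ _ (fun=> 0) (fun i =>
      L1 * (lam i * phi (L2 * edist (x i) p)) + edist (lam i *: (y i - q)) w)).
    + apply: filterS hx => i [_ _ yfx]; rewrite edist_ge0 /=.
      rewrite (le_trans (edist_triangle (lam i *: (y i - q)) _ _)) // lerD2r.
      by rewrite edist_scale_shift ?(ltW (lam_pos i)) // mulrCA ler_pM2l // edistC.
    + exact: cvg_cst.
    + rewrite -[X in _ --> X](addr0 0) -[X in _ --> X + _](mulr0 L1).
      by apply: cvgD; [exact: cvgMr|apply/cvg_edistP].
  (* The value [g v] was obtained from another sequence [x'], which has the same rescaled limit [v]
     as the lifts [x]. The upper bound [L * edist v v = 0] therefore identifies [g v] with [w]. *)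
  exists v => //; have [x' [Xx' xv' fx']] := hg v Cv.
  have [_] := limit_bounds _ _ _ _ _ _ Xx' Xx xv' xv fx' fw.
  rewrite edistxx mulr0 => gw.
  by apply: edist_eq0; apply/eqP; rewrite eq_le gw edist_ge0.
Unshelve. all: by end_near. Qed.
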